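(* Let $q$ be a prime power, $0<\delta<1$, and $0<1/n\ll\theta\ll\epsilon\ll1/q$. Let $H$ be a $(q+1)$-graph on a set $X$ of $n$ vertices with $d_{PG_2(q)}(H)<\theta$ such that the $q$-graph $G=\{Q\in\binom{X}{q}: |N_H(Q)|<\delta n\}$ has density $d(G)<\theta$. Then there is $Z\subseteq X$ with $|Z|>(\delta-\epsilon)n$ and $d(H[Z])<\epsilon$.
   Context: Hierarchy convention: ''$0<\alpha\ll\beta$'' means there is an increasing function $f$ such that the statement holds whenever $0<\alpha<f(\beta)$; chains are read right to left. For a $k$-graph $H$ and $S\subseteq V(H)$, $N_H(S)=\{T\subseteq V(H)\setminus S:S\cup T\in E(H)\}$; $H[Z]$ is the subgraph of edges contained in $Z$. The density of a $k$-graph $G$ on $m$ vertices is $d(G)=k!|E(G)|/m^k$. $d_F(H)$ is the probability that a uniformly random map $\phi:V(F)\to V(H)$ sends every edge of $F$ to an edge of $H$. $PG_2(q)$ is the $(q+1)$-graph whose vertices are the one-dimensional subspaces of $\mathbb{F}_q^3$ and whose edges are, for each two-dimensional subspace, the set of one-dimensional subspaces it contains. *)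

(* Defs.v *)
From HB Require Import structures.
From mathcomp Require Import all_boot all_order all_algebra all_fingroup all_field.
Set Implicit Arguments. Unset Strict Implicit. Unset Printing Implicit Defensive.
Import Order.TTheory GRing.Theory Num.Theory.
Local Open Scope ring_scope.

(* Projective plane PG_2(K) over a finite field K (q = #|K|).
   Subspaces of K^3 = 'rV[K]_3 are represented canonically by the square
   matrix <<A>>%MS spanning them. *)
Definition PGpoint (K : finFieldType) : finType :=
  {A : 'M[K]_3 | (<<A>>%MS == A) && (\rank A == 1)%N}.
Definition PGline (K : finFieldType) : finType :=
  {A : 'M[K]_3 | (<<A>>%MS == A) && (\rank A == 2)%N}.

Definition PG2_edges (K : finFieldType) : {set {set PGpoint K}} :=
  [set [set P : PGpoint K | (val P <= val L)%MS] | L : PGline K].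

Definition homdens (R : numFieldType) (V : finType) (EF : {set {set V}})
  (n : nat) (H : {set {set 'I_n}}) : R :=
  (#|[set phi : {ffun V -> 'I_n} | [forall e in EF, (phi @: e) \in H]]|%:R)
  / ((n ^ #|V|)%N)%:R.

Definition dens (R : numFieldType) (k m : nat) (T : finType) (E : {set {set T}}) : R :=
  ((k`! * #|E|)%N)%:R / ((m ^ k)%N)%:R.

Definition NH (n : nat) (H : {set {set 'I_n}}) (S : {set 'I_n}) : {set {set 'I_n}} :=
  [set T : {set 'I_n} | [disjoint T & S] && ((S :|: T) \in H)].

Definition lowdeg (R : numFieldType) (n q : nat) (H : {set {set 'I_n}}) (delta : R)
  : {set {set 'I_n}} :=
  [set Q : {set 'I_n} | (#|Q| == q)%N && (#|NH H Q|%:R < delta * n%:R)].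

Definition induced (n : nat) (H : {set {set 'I_n}}) (Z : {set 'I_n}) : {set {set 'I_n}} :=
  [set e in H | e \subset Z].

(* Main.v *)
(** If no Z works, then for almost every q-set Q the neighbourhood N(Q) has size
    at least delta n and spans a positive proportion of all (q+1)-sets.  Take a
    bounded number of random vertices; with probability at least 1/2 all their
    q-subsets Q are of this kind.  The indicator functions g_Q of the N(Q) are
    indexed by the q-subsets of a large bounded set T, and Ramsey's theorem,
    applied to the inner products of these functions, passes to a subset of T on
    which the g_Q have iterated weak limits g_u, for sequences u of length < q:
    the vectors g_(p :: u) - g_u, p varying, are nearly orthogonal.  Since weak
    limits commute with tensor products, g = g_[::] satisfies
    E h(z_0, ..., z_q) g(z_0) ... g(z_q) > 0, where h is the indicator of H, and
    hence also E h (g(z_0) ... g(z_q))^m > 0 for every m.  Now fix a line at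
    infinity of PG_2(q), carrying z_0, ..., z_q, and choose the affine points in T
    one at a time.  Each affine point lies on exactly one line of each parallel
    class, so it enters only one factor per variable z_i and replacing g_u by
    g_(p :: u) for these factors hardly changes the expectation.  When all affine
    points are chosen, the expectation is the density of copies of PG_2(q) with the
    chosen affine part; averaging over T contradicts the sparsity of PG_2(q). *)

Require Import Defs.
From HB Require Import structures.
From mathcomp Require Import all_boot all_order all_algebra all_fingroup all_field.
From mathcomp Require Import ring lra.
Import Order.TTheory GRing.Theory Num.Theory.
Set Implicit Arguments. Unset Strict Implicit. Unset Printing Implicit Defensive.
Local Open Scope ring_scope.

(** * Subsequences and Ramsey's theorem for sequences *)

Lemma subseq_drop_le (I : eqType) (t : seq I) (m n : nat) :
  (m <= n)%N -> subseq (drop n t) (drop m t).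
Proof. by move=> le_mn; rewrite -(subnK le_mn) -drop_drop drop_subseq. Qed.

Lemma subseq_cons_nth (I : eqType) (x0 : I) (u t : seq I) (i k : nat) :
  (i < k <= size t)%N -> subseq u (drop k t) ->
  subseq (nth x0 t i :: u) (drop i t).
Proof.
move=> /andP[lt_ik le_kt] sut.
rewrite (drop_nth x0) ?(leq_trans lt_ik) //= eqxx.
exact: subseq_trans sut (subseq_drop_le _ lt_ik).
Qed.

Lemma pigeonhole_seq (I : eqType) (C : finType) (c : I -> C) (L : nat) (t : seq I) :
  (L * #|C| < size t)%N -> exists k : C, (L < count (fun x => c x == k) t)%N.
Proof.
move=> lt_t; apply/existsP; apply: contraLR lt_t => /existsPn small.
rewrite -leqNgt -count_predT.
have -> : count predT t = (\sum_(k : C) count (fun x => c x == k) t)%N.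
  elim: t {small} => [|x t IHt] /=; first by rewrite big1.
  rewrite IHt big_split /=; congr (_ + _)%N.
  by rewrite (bigD1 (c x)) //= eqxx big1 // => k /negPf; rewrite eq_sym => ->.
by rewrite mulnC -sum_nat_const leq_sum // => k _; rewrite leqNgt small.
Qed.

(** Induction on [r], with [M] uniform in the ground type and the colouring: first make the colour
    of [x :: u] depend on the head [x] alone, then apply the pigeonhole principle to the heads. *)
Theorem ramsey_seq (C : finType) (r L : nat) : exists M : nat,
  forall (I : eqType) (f : seq I -> C) (s : seq I), uniq s -> (M <= size s)%N ->
  exists t c, [/\ subseq t s, (L <= size t)%N &
    forall u, subseq u t -> size u = r -> f u = c].
Proof.
elim: r L => [|r IHr] L.
  exists L => I f s _ le_s; exists s, (f [::]); split=> // u _ /eqP.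
  by rewrite size_eq0 => /eqP ->.
(* Each new head [x] colours the sequences [u] of length [r] by [f (x :: u)]; the induction
   hypothesis makes this colouring constant on a long remainder, from which all later heads are
   taken. *)
have [M prehom] : exists M : nat, forall (I : eqType) (f : seq I -> C) (s : seq I),
    uniq s -> (M <= size s)%N -> exists (t : seq I) (c : I -> C),
    [/\ subseq t s, (L * #|C| < size t)%N &
      forall x u, subseq (x :: u) t -> size u = r -> f (x :: u) = c x].
  elim: (L * #|C|)%N => [|m [M IHm]].
    have [M' IHr'] := IHr 0%N; exists M'.+1 => I f [//|x s] /andP[_ us].
    rewrite ltnS => le_s.
    have [t [c [sts _ homt]]] := IHr' I (fun u => f (x :: u)) s us le_s.
    exists [:: x], (fun=> c); split=> //=; first by rewrite eqxx sub0seq.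
    by move=> y [|z u] /=; case: (eqVneq y x) => // -> _ sz0; apply: homt; rewrite ?sub0seq.
  have [M' IHr'] := IHr M; exists M'.+1 => I f [//|x s] /= /andP[xs us].
  rewrite ltnS => le_s.
  have [t [c [sts le_t homt]]] := IHr' I (fun u => f (x :: u)) s us le_s.
  have ut := subseq_uniq sts us.
  have [t' [c' [st't le_t' homt']]] := IHm I f t ut le_t.
  exists (x :: t'), (fun y => if y == x then c else c' y); split.
  - by rewrite /= eqxx (subseq_trans st't sts).
  - by rewrite /= ltnS.
  move=> y u /=; case: eqP => [-> sut' szu | _ syut' szu].
    by apply: homt => //; apply: subseq_trans sut' st't.
  by apply: homt'.
exists M => I f s us le_s; have [t [c [sts lt_t homt]]] := prehom I f s us le_s.
have [k lt_k] := pigeonhole_seq c lt_t.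
exists (filter (fun x => c x == k) t), k; split.
- exact: subseq_trans (filter_subseq _ _) sts.
- by rewrite size_filter ltnW.
case=> [//|x u] sxu [szu].
rewrite (homt x u (subseq_trans sxu (filter_subseq _ _)) szu).
by have := mem_subseq sxu (mem_head _ _); rewrite mem_filter => /andP[/eqP].
Qed.

(** * Averages over finite types and decoupling of products *)

Section Averages.
Variable R : realFieldType.
Implicit Types T X A P : finType.

(** Uniform expectation. On an empty type it is [0], because [0^-1 = 0]; hence the sign or
    nonemptiness conditions in the bounds below. *)
Definition avg T (F : T -> R) : R := (\sum_x F x) / #|T|%:R.

Lemma eq_avg T (F G : T -> R) : F =1 G -> avg F = avg G.
Proof. by move=> eFG; rewrite /avg (eq_bigr G). Qed.

Lemma avgD T (F G : T -> R) : avg (fun x => F x + G x) = avg F + avg G.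
Proof. by rewrite /avg big_split mulrDl. Qed.

Lemma avgB T (F G : T -> R) : avg (fun x => F x - G x) = avg F - avg G.
Proof. by rewrite /avg sumrB mulrBl. Qed.

Lemma avgZ T (c : R) (F : T -> R) : avg (fun x => c * F x) = c * avg F.
Proof. by rewrite /avg -mulr_sumr mulrA. Qed.

Lemma avgZr T (c : R) (F : T -> R) : avg (fun x => F x * c) = avg F * c.
Proof. by rewrite [RHS]mulrC -avgZ; apply: eq_avg => x; rewrite mulrC. Qed.

Lemma exchange_avg T X (F : T -> X -> R) :
  avg (fun x => avg (F x)) = avg (fun y => avg (F^~ y)).
Proof.
rewrite /avg -!mulr_suml exchange_big /= -!mulrA; congr (_ * _).
exact: mulrC.
Qed.

Lemma ler_avg T (F G : T -> R) : (forall x, F x <= G x) -> avg F <= avg G.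
Proof. by move=> leFG; rewrite ler_wpM2r ?invr_ge0 ?ler0n ?ler_sum. Qed.

Lemma ler_avg_norm T (F : T -> R) : `|avg F| <= avg (fun x => `|F x|).
Proof.
by rewrite normrM normfV normr_nat ler_wpM2r ?invr_ge0 ?ler0n ?ler_norm_sum.
Qed.

Lemma avg_cst T (c : R) : (0 < #|T|)%N -> avg (fun _ : T => c) = c.
Proof.
by move=> T0; rewrite /avg sumr_const -[c *+ _]mulr_natr mulfK // pnatr_eq0 -lt0n.
Qed.

Lemma avg_ge0 T (F : T -> R) : (forall x, 0 <= F x) -> 0 <= avg F.
Proof. by move=> F0; rewrite divr_ge0 ?sumr_ge0. Qed.

Lemma avg_le T (F : T -> R) (c : R) : 0 <= c -> (forall x, F x <= c) -> avg F <= c.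
Proof.
move=> c0 Fc; have [T0|T0] := posnP #|T|.
  by rewrite /avg T0 invr0 mulr0.
by rewrite -(avg_cst c T0) ler_avg.
Qed.

Lemma avg_norm_le T (F : T -> R) (c : R) :
  0 <= c -> (forall x, `|F x| <= c) -> `|avg F| <= c.
Proof. by move=> c0 Fc; rewrite (le_trans (ler_avg_norm F)) ?avg_le. Qed.

Lemma avg_sqr T (F : T -> R) : avg F ^+ 2 <= avg (fun x => F x ^+ 2).
Proof.
have [T0|T0] := posnP #|T|; first by rewrite /avg T0 invr0 !mulr0 expr0n.
rewrite -subr_ge0; set m := avg F.
have -> : avg (fun x => F x ^+ 2) - m ^+ 2 = avg (fun x => (F x - m) ^+ 2).
  transitivity (avg (fun x => F x ^+ 2) - avg (fun x => 2 * m * F x)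
                + avg (fun _ : T => m ^+ 2)).
    by rewrite avgZ avg_cst // -/m; ring.
  by rewrite -avgB -avgD; apply: eq_avg => x; ring.
by apply: avg_ge0 => x; rewrite sqr_ge0.
Qed.

Lemma avg_prod A X (F : A -> X -> R) :
  avg (fun z : {ffun A -> X} => \prod_a F a (z a)) = \prod_a avg (F a).
Proof.
rewrite /avg -bigA_distr_bigA /= big_split /=; congr (_ * _).
by rewrite prodr_const card_ffun natrX exprVn.
Qed.

Lemma avg_max T (F : T -> R) : (0 < #|T|)%N -> exists x, avg F <= F x.
Proof.
move=> T0; have [x le_x|no] := pickP (fun x => avg F <= F x); first by exists x.
have /card_gt0P [x0 _] := T0.
have : \sum_(x : T) F x < \sum_(x : T) avg F.
  apply: ltr_sum => [|x _]; last by rewrite ltNge no.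
  by apply/hasP; exists x0; rewrite ?mem_index_enum.
by rewrite sumr_const -[avg F *+ _]mulr_natr /avg divfK ?ltxx // pnatr_eq0 -lt0n.
Qed.

Lemma prod_norm_le1 A (F : A -> R) (Q : pred A) :
  (forall a, `|F a| <= 1) -> `|\prod_(a | Q a) F a| <= 1.
Proof.
move=> F1; rewrite normr_prod; apply: prodr_ile1 => a _.
by rewrite normr_ge0 F1.
Qed.

(* Cauchy--Schwarz removes f, after which the square of the average over p
   factorizes over the coordinates. *)
Lemma avg_quasi_orthogonal A X P (f : {ffun A -> X} -> R) (u : P -> A -> X -> R)
    (a0 : A) (gam eta : R) :
  (0 < #|P|)%N -> 0 <= eta -> 0 <= gam -> #|P|%:R^-1 + gam <= eta ^+ 2 ->
  (forall z, `|f z| <= 1) -> (forall p a x, `|u p a x| <= 1) ->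
  (forall p p', p != p' -> `|avg (fun x => u p a0 x * u p' a0 x)| <= gam) ->
  `|avg (fun p => avg (fun z => f z * \prod_a u p a (z a)))| <= eta.
Proof.
move=> P0 eta0 gam0 le_eta f1 u1 orth.
rewrite exchange_avg.
rewrite -(ler_pXn2r (n := 2)) ?nnegrE // real_normK ?num_real //.
apply: le_trans _ le_eta; apply: le_trans (avg_sqr _) _.
pose Y (z : {ffun A -> X}) := avg (fun p => \prod_a u p a (z a)).
apply: (@le_trans _ _ (avg (fun z => Y z ^+ 2))).
  apply: ler_avg => z; rewrite avgZ exprMn ler_piMl ?sqr_ge0 //.
  by rewrite -real_normK ?num_real // expr_le1.
have -> : avg (fun z => Y z ^+ 2) =
    avg (fun p => avg (fun p' => \prod_a avg (fun x => u p a x * u p' a x))).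
  transitivity (avg (fun z : {ffun A -> X} => avg (fun p => avg (fun p' =>
      \prod_a (u p a (z a) * u p' a (z a)))))).
    apply: eq_avg => z; rewrite expr2 {1}/Y -avgZr; apply: eq_avg => p.
    by rewrite -avgZ; apply: eq_avg => p'; rewrite big_split.
  rewrite [LHS]exchange_avg; apply: eq_avg => p; rewrite [LHS]exchange_avg.
  by apply: eq_avg => p'; rewrite -avg_prod.
have avg1 p p' a : `|avg (fun x => u p a x * u p' a x)| <= 1.
  by apply: avg_norm_le => // x; rewrite normrM mulr_ile1.
(* Only the diagonal pairs escape near-orthogonality; they are bounded by [1] and have proportion
   [#|P|^-1]. The factors at coordinates other than [a0] are bounded by [1]. *)
apply: (@le_trans _ _ (avg (fun p => avg (fun p' => (p' == p)%:R + gam)))).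
  apply: ler_avg => p; apply: ler_avg => p'.
  apply: le_trans (ler_norm _) _; rewrite (bigD1 a0) //= normrM.
  apply: (@le_trans _ _ `|avg (fun x => u p a0 x * u p' a0 x)|).
    by rewrite ler_piMr // prod_norm_le1.
  have [->|ne] := eqVneq p' p; first by apply: le_trans (avg1 _ _ _) _; rewrite lerDl.
  by rewrite add0r orth // eq_sym.
apply: avg_le => [|p]; first by rewrite addr_ge0 ?invr_ge0.
rewrite avgD avg_cst // lerD2r /avg (bigD1 p) //= eqxx big1 ?addr0 ?mul1r //.
by move=> p' /negPf ->.
Qed.

(** Hybrid argument: the factors [w p a] are replaced by [w0 a] one coordinate at a time. One
    replacement leaves the difference [w p a0 - w0 a0] in coordinate [a0], so [avg_quasi_orthogonal]
    bounds its cost by [eta]. *)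
Lemma avg_decouple A X P (f : {ffun A -> X} -> R) (w0 : A -> X -> R)
    (w : P -> A -> X -> R) (gam eta : R) :
  (0 < #|P|)%N -> 0 <= eta -> 0 <= gam -> #|P|%:R^-1 + gam <= eta ^+ 2 ->
  (forall z, `|f z| <= 1) -> (forall a x, 0 <= w0 a x <= 1) ->
  (forall p a x, 0 <= w p a x <= 1) ->
  (forall a p p', p != p' ->
    `|avg (fun x => (w p a x - w0 a x) * (w p' a x - w0 a x))| <= gam) ->
  `|avg (fun p => avg (fun z => f z * \prod_a w p a (z a)))
    - avg (fun z => f z * \prod_a w0 a (z a))| <= #|A|%:R * eta.
Proof.
move=> P0 eta0 gam0 le_eta f1 w01 w1 orth.
(* The coordinates listed in [r] are those already replaced. *)
pose hyb (r : seq A) p a := if a \in r then w0 a else w p a.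
pose Phi r := avg (fun p => avg (fun z => f z * \prod_a hyb r p a (z a))).
have hyb1 r p a x : 0 <= hyb r p a x <= 1 by rewrite /hyb; case: ifP.
suff step r : uniq r -> `|Phi [::] - Phi r| <= (size r)%:R * eta.
  have := step (enum A) (enum_uniq A); rewrite -cardE.
  congr (`| _ - _ | <= _).
  transitivity (avg (fun _ : P => avg (fun z => f z * \prod_a w0 a (z a)))).
    apply: eq_avg => p; apply: eq_avg => z; congr (_ * _).
    by apply: eq_bigr => a _; rewrite /hyb mem_enum.
  by rewrite avg_cst.
elim: r => [_|a0 r IHr /= /andP[a0r ur]]; first by rewrite subrr normr0 mul0r.
have -> : Phi [::] - Phi (a0 :: r) = (Phi [::] - Phi r) + (Phi r - Phi (a0 :: r)).
  by ring.
rewrite -natr1 mulrDl mul1r (le_trans (ler_normD _ _)) // lerD ?IHr //.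
pose u p a x := if a == a0 then w p a x - w0 a x else hyb r p a x.
have -> : Phi r - Phi (a0 :: r) =
    avg (fun p => avg (fun z => f z * \prod_a u p a (z a))).
  rewrite /Phi -avgB; apply: eq_avg => p; rewrite -avgB; apply: eq_avg => z.
  rewrite -mulrBr; congr (_ * _).
  rewrite (bigD1 a0) //= [X in _ - X](bigD1 a0) //= [RHS](bigD1 a0) //=.
  rewrite {1 3}/hyb /u eqxx mem_head (negPf a0r) mulrBl; congr (_ * _ - _ * _).
    by apply: eq_bigr => a /negPf ->.
  by apply: eq_bigr => a /negPf na; rewrite /hyb in_cons na.
apply: (@avg_quasi_orthogonal _ _ _ f u a0 gam) => //.
  move=> p a x; rewrite /u; case: ifP => _.
    have /andP[? ?] := w1 p a x; have /andP[? ?] := w01 a x.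
    by rewrite ler_norml; apply/andP; split; lra.
  by have /andP[? ?] := hyb1 r p a x; rewrite ger0_norm.
by move=> p p' ne; rewrite /u eqxx orth.
Qed.

End Averages.

Lemma avg_eq_delta (R : realFieldType) (T : finType) (x0 : T) :
  avg (fun x => (x == x0)%:R : R) = #|T|%:R^-1.
Proof.
by rewrite /avg (bigD1 x0) //= eqxx big1 ?addr0 ?mul1r // => x /negPf ->.
Qed.

(** * Iterated weak limits of families of functions indexed by sequences *)

Section WeakLimits.
Variable R : archiRealFieldType.

(* Ramsey makes the inner products of g (b :: u) and g (a :: u) nearly constant;
   then the average over the front block is almost a common orthogonal
   projection of all the g (p :: u). *)
Lemma weak_limit_step (q : nat) (gam : R) (N : nat) : 0 < gam ->
  exists M : nat, forall (I : eqType) (X : finType) (g : seq I -> X -> R) (s : seq I),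
  uniq s -> (M <= size s)%N -> (forall u x, 0 <= g u x <= 1) ->
  exists (t : seq I) (G : seq I -> X -> R),
  [/\ subseq t s, (N <= size t)%N, (forall u x, 0 <= G u x <= 1) &
    forall u p p', subseq (p' :: p :: u) t -> size u = q ->
    `|avg (fun x => (g (p :: u) x - G u x) * (g (p' :: u) x - G u x))| <= gam].
Proof.
(* [k] is both the length of the front block and the fineness of the colouring. The final error is
   [5 / k]: four inner products contribute [1 / k] each, the diagonal of the block another
   [1 / k]. *)
move=> gam0; pose k := (Num.truncn (5 / gam)).+1.
have k0 : 0 < k%:R :> R by rewrite ltr0n.
have kgam : 5 / k%:R <= gam.
  rewrite ler_pdivrMr // mulrC -ler_pdivrMr //.
  exact: ltW (truncnS_gt _).
have [M ram] := ramsey_seq 'I_k.+1 q.+2 (N + k)%N.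
exists M => I X g s us le_s g1.
pose pr v w := avg (fun x => g v x * g w x).
have prC v w : pr v w = pr w v by apply: eq_avg => x; rewrite mulrC.
have pr1 v w : 0 <= pr v w <= 1.
  apply/andP; split.
    by apply: avg_ge0 => x; have /andP[? _] := g1 v x; have /andP[? _] := g1 w x; rewrite mulr_ge0.
  by apply: avg_le => // x; have /andP[? ?] := g1 v x; have /andP[? ?] := g1 w x; rewrite mulr_ile1.
(* The colour is the inner product rounded down to a multiple of [1 / k]; the value [1] needs the
   extra colour [k]. *)
pose f (v : seq I) : 'I_k.+1 :=
  if v is b :: a :: u then inord (Num.truncn (k%:R * pr (b :: u) (a :: u))) else ord0.
have [t [c [sts le_t homt]]] := ram I f s us le_s.
have ut := subseq_uniq sts us.
have [x0 _] : exists x0 : I, x0 \in t.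
  by case: t le_t {sts homt ut} => [|x0 t _]; [rewrite addnS | exists x0; rewrite mem_head].
pose kap : R := c%:R / k%:R.
have near b a u : subseq (b :: a :: u) t -> size u = q ->
    `|pr (b :: u) (a :: u) - kap| <= k%:R^-1.
  move=> sub szu; have := homt _ sub; rewrite /= szu => /(_ erefl) fc.
  have /andP[p0 p1] := pr1 (b :: u) (a :: u).
  set y := pr _ _ in fc p0 p1 *.
  have /andP[le1 lt1] : (Num.truncn (k%:R * y))%:R <= k%:R * y
      < (Num.truncn (k%:R * y)).+1%:R by rewrite truncn_itv // mulr_ge0 // ltW.
  have tr_le : (Num.truncn (k%:R * y) < k.+1)%N.
    by rewrite -(ltr_nat R) (le_lt_trans le1) // -natr1 ltr_pwDr // ler_piMr // ltW.
  have fcE : c = Num.truncn (k%:R * y) :> nat by rewrite -fc inordK.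
  rewrite -fcE -natr1 in le1 lt1.
  have -> : y - kap = (k%:R * y - c%:R) / k%:R by rewrite /kap; field; rewrite gt_eqF.
  rewrite normrM normfV (gtr0_norm k0) ler_piMl ?invr_ge0 ?ltW //.
  by rewrite ger0_norm; lra.
pose ci (i : 'I_k) := nth x0 t i.
(* The weak limit is the average over the first [k] entries of [t]. Only the entries after this
   block are kept, so that each [ci i] may stand in front of any remaining sequence. *)
pose G u x := avg (fun i : 'I_k => g (ci i :: u) x).
exists (drop k t), G; split.
- exact: subseq_trans (drop_subseq _ _) sts.
- by rewrite size_drop leq_subRL // ?(leq_trans (leq_addl _ _) le_t) // addnC.
- move=> u x; apply/andP; split; last first.
    by apply: avg_le => // i; have /andP[] := g1 (ci i :: u) x.
  by apply: avg_ge0 => // i; have /andP[] := g1 (ci i :: u) x.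
move=> u p p' sub szu; apply: le_trans kgam.
have k0n : (0 < #|'I_k|)%N by rewrite card_ord.
(* The inner product of the two differences, expanded. Its four terms are all near [kap] and cancel,
   except that for [i = j] the last one is a squared norm, which the colouring does not control. *)
pose D i j := pr (p' :: u) (p :: u) - pr (ci j :: u) (p :: u)
  - pr (ci i :: u) (p' :: u) + pr (ci i :: u) (ci j :: u).
have -> : avg (fun x => (g (p :: u) x - G u x) * (g (p' :: u) x - G u x)) =
    avg (fun i => avg (D i)).
  transitivity (avg (fun x => avg (fun i => avg (fun j =>
      (g (p :: u) x - g (ci i :: u) x) * (g (p' :: u) x - g (ci j :: u) x))))).
    apply: eq_avg => x; transitivity (avg (fun i => (g (p :: u) x - g (ci i :: u) x)
        * (g (p' :: u) x - G u x))).
      by rewrite avgZr avgB avg_cst.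
    by apply: eq_avg => i; rewrite avgZ avgB avg_cst.
  rewrite [LHS]exchange_avg; apply: eq_avg => i; rewrite [LHS]exchange_avg.
  apply: eq_avg => j; rewrite /D /pr -!avgB -avgD; apply: eq_avg => x; ring.
have le_kt : (k <= size t)%N := leq_trans (leq_addl _ _) le_t.
have sub1 i v : subseq v (drop k t) -> subseq (ci i :: v) (drop i t).
  by apply: subseq_cons_nth; rewrite ltn_ord.
have subp : subseq (p :: u) (drop k t).
  by apply: subseq_trans sub; rewrite subseq_cons.
have subp' : subseq (p' :: u) (drop k t).
  by apply: subseq_trans sub; rewrite /= eqxx; exact: subseq_cons.
have subu : subseq u (drop k t) by apply: subseq_trans subp; rewrite subseq_cons.
have subt i v : subseq v (drop i t) -> subseq v t.
  by move=> sv; apply: subseq_trans sv (drop_subseq _ _).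
have near2 (i j : 'I_k) : i != j -> `|pr (ci i :: u) (ci j :: u) - kap| <= k%:R^-1.
  wlog lt_ij : i j / (i < j)%N.
    move=> wl ne; have [lt|lt|/val_inj eq_ij] := ltngtP i j; first exact: wl.
      by rewrite prC wl // eq_sym.
    by rewrite eq_ij eqxx in ne.
  move=> _; apply: near => //; apply: (subt i).
  apply: subseq_cons_nth (sub1 j u subu).
  by rewrite lt_ij ltnW // (leq_trans (ltn_ord j)).
have Dle i j : `|D i j| <= 4 / k%:R + (j == i)%:R.
  have d1 := near _ _ _ (subt _ _ sub) szu.
  have d2 := near _ _ _ (subt _ _ (sub1 j _ subp)) szu.
  have d3 := near _ _ _ (subt _ _ (sub1 i _ subp')) szu.
  have d4 : `|pr (ci i :: u) (ci j :: u) - kap| <= k%:R^-1 + (j == i)%:R.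
    have [ji|ne] := eqVneq j i; last by rewrite addr0 near2 // eq_sym.
    have lek : c%:R <= k%:R :> R by rewrite ler_nat -ltnS.
    have /andP[p0 p1] := pr1 (ci i :: u) (ci j :: u).
    have kap1 : 0 <= kap <= 1.
      by rewrite /kap divr_ge0 ?ler0n //= ler_pdivrMr // mul1r.
    have ki0 : 0 <= k%:R^-1 :> R by rewrite invr_ge0 ltW.
    by rewrite ler_norml; apply/andP; split; move: kap1 => /andP[? ?] /=; lra.
  move: d1 d2 d3 d4; rewrite !ler_norml /D => /andP[? ?] /andP[? ?] /andP[? ?] /andP[? ?].
  by apply/andP; split; lra.
apply: avg_norm_le => [|i]; first by rewrite divr_ge0 // ltW.
apply: le_trans (ler_avg_norm _) _.
apply: le_trans (ler_avg (Dle i)) _.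
rewrite avgD avg_cst // avg_eq_delta card_ord.
lra.
Qed.

(** Induction on [q]: one weak limit takes the functions at length [q.+1] to length [q], and the
    induction hypothesis treats these limits as the new top level. *)
Theorem weak_limits (q : nat) (gam : R) (N : nat) : 0 < gam ->
  exists M : nat, forall (I : eqType) (X : finType) (g : seq I -> X -> R) (s : seq I),
  uniq s -> (M <= size s)%N -> (forall u x, 0 <= g u x <= 1) ->
  exists (t : seq I) (G : seq I -> X -> R),
  [/\ subseq t s, (N <= size t)%N, (forall u x, 0 <= G u x <= 1),
    (forall u, size u = q -> G u = g u) &
    forall u p p', subseq (p' :: p :: u) t -> (size u < q)%N ->
    `|avg (fun x => (G (p :: u) x - G u x) * (G (p' :: u) x - G u x))| <= gam].
Proof.
move=> gam0; elim: q N => [|q IHq] N.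
  by exists N => I X g s us le_s g1; exists s, g; split.
have [M' lim'] := IHq N; have [M step] := weak_limit_step q M' gam0.
exists M => I X g s us le_s g1.
have [t [G [sts le_t G1 orth]]] := step I X g s us le_s g1.
have [t' [G' [st't le_t' G'1 G'E orth']]] :=
  lim' I X G t (subseq_uniq sts us) le_t G1.
(* At length [q] the family [G'] agrees with the first limit [G], so the two orthogonality
   statements fit together there. *)
exists t', (fun u => if (size u == q.+1)%N then g u else G' u); split=> //.
- exact: subseq_trans st't sts.
- by move=> u x; case: ifP.
- by move=> u ->; rewrite eqxx.
move=> u p p' sub; rewrite ltnS => le_u /=; rewrite eqSS [size u == q.+1]ltn_eqF //.
have [szu|ne] := eqVneq (size u) q.
  by rewrite G'E //; apply: orth => //; apply: subseq_trans sub st't.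
by apply: orth' => //; rewrite ltn_neqAle ne.
Qed.

End WeakLimits.

(** * Embedding the affine points by weak limits *)

Section Embedding.
(** An affine plane seen through its parallel classes: [V] consists of the points, [Lns] of the
    lines, [A] of the classes, that is, the points at infinity. The line of class [a] through [v] is
    [lam v a]. *)
Variables (R : archiRealFieldType) (A V Lns : finType).
Variables (inc : V -> Lns -> bool) (cls : Lns -> A) (lam : V -> A -> Lns) (q : nat).
Hypothesis inc_lam : forall v a, inc v (lam v a).
Hypothesis cls_lam : forall v a, cls (lam v a) = a.
Hypothesis lam_cls : forall v l, inc v l -> lam v (cls l) = l.
Hypothesis card_line : forall l, #|[set v | inc v l]| = q.

Section WeakLimitFamily.
Variables (I : eqType) (X : finType) (G : seq I -> X -> R) (t : seq I) (x0 : I).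
Variables (gam eta : R) (L : nat).
Hypotheses (L0 : (0 < L)%N) (eta0 : 0 <= eta) (gam0 : 0 <= gam).
Hypothesis le_eta : L%:R^-1 + gam <= eta ^+ 2.
Hypothesis G1 : forall u x, 0 <= G u x <= 1.
Hypothesis orth : forall u p p', subseq (p' :: p :: u) t -> (size u < q)%N ->
  `|avg (fun x => (G (p :: u) x - G u x) * (G (p' :: u) x - G u x))| <= gam.

(** The index [p] runs over the block of [L] entries of [t] just before position [k]. All [us a] lie
    after it, so [orth] applies to any two entries of the block and [avg_decouple] gives the
    bound. *)
Lemma avg_extend (k : nat) (us : A -> seq I) (f : {ffun A -> X} -> R) :
  (L <= k <= size t)%N -> (forall a, subseq (us a) (drop k t)) ->
  (forall a, (size (us a) < q)%N) -> (forall z, `|f z| <= 1) ->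
  `|avg (fun p : 'I_L => avg (fun z =>
        f z * \prod_a G (nth x0 t (k - L + p)%N :: us a) (z a)))
    - avg (fun z => f z * \prod_a G (us a) (z a))| <= #|A|%:R * eta.
Proof.
move=> /andP[le_Lk le_kt] sub lt_us f1.
apply: (@avg_decouple _ _ _ _ f (fun a => G (us a))
  (fun (p : 'I_L) a => G (nth x0 t (k - L + p)%N :: us a)) gam) => //;
  rewrite ?card_ord //.
move=> a p p'; wlog lt_pp' : p p' / (p' < p)%N.
  move=> wl ne; have [lt|lt|/val_inj eqp] := ltngtP p p'; last by rewrite eqp eqxx in ne.
    rewrite eq_sym in ne; have := wl p' p lt ne.
    by congr (`|_| <= _); apply: eq_avg => x; rewrite mulrC.
  exact: wl.
move=> _; apply: orth => //.
have ltk i : (i < L)%N -> (k - L + i < k)%N by move=> lt; rewrite -ltn_subRL subKn.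
apply: subseq_trans _ (drop_subseq t (k - L + p')%N).
apply: (@subseq_cons_nth _ _ _ _ _ (k - L + p)%N).
  by rewrite ltn_add2l lt_pp' ltnW // (leq_trans (ltk _ _)).
by apply: subseq_cons_nth (sub a); rewrite ltk.
Qed.

Lemma nth_block (k : nat) (p : 'I_L) (u : seq I) :
  (L <= k <= size t)%N -> subseq u (drop k t) ->
  subseq (nth x0 t (k - L + p)%N :: u) (drop (k - L)%N t).
Proof.
move=> /andP[le_Lk le_kt] sub.
apply: (@subseq_trans _ (drop (k - L + p)%N t)); last first.
  by rewrite subseq_drop_le // leq_addr.
by apply: subseq_cons_nth sub; rewrite -ltn_subRL subKn ?ltn_ord.
Qed.

Variable h : {ffun A -> X} -> R.
Hypothesis h1 : forall z, 0 <= h z <= 1.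

Let h_norm z : `|h z| <= 1.
Proof. by have /andP[? ?] := h1 z; rewrite ger0_norm. Qed.

(** Transfers a lower bound for sequences of length [q] to the root [[::]]. The sequence [u] grows
    from the back of [t], one block of [L] entries per step, taking in each block an entry whose
    value is at most the block average. *)
Lemma avg_root_ge (j : nat) : (j <= q)%N -> (j * L <= size t)%N ->
  exists u, [/\ size u = j, subseq u (drop (size t - j * L)%N t) &
    avg (fun z => h z * \prod_a G u (z a))
    <= avg (fun z => h z * \prod_a G [::] (z a)) + j%:R * (#|A|%:R * eta)].
Proof.
elim: j => [|j IHj] le_jq le_jt.
  by exists [::]; rewrite sub0seq mul0r addr0.
have [||u [szu sub le_u]] := IHj; first exact: ltnW.
  by apply: leq_trans le_jt; rewrite leq_mul.
set k := (size t - j * L)%N in sub.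
have le_k : (L <= k <= size t)%N by rewrite leq_subr leq_subRL 1?addnC -?mulSn // (leq_trans _ le_jt) ?leq_mul.
have := avg_extend le_k (fun=> sub) (fun=> _) h_norm.
rewrite szu => /(_ (fun=> le_jq)); set F := fun p : 'I_L => _.
rewrite ler_norml => /andP[_ le_F].
have [p le_p] : exists p, F p <= avg F.
  have [|p] := avg_max (fun p => - F p); first by rewrite card_ord.
  have -> : avg (fun p => - F p) = - avg F by rewrite /avg sumrN mulNr.
  by rewrite lerN2; exists p.
exists (nth x0 t (k - L + p)%N :: u); split; first by rewrite /= szu.
  by rewrite mulSn (addnC L) subnDA; apply: nth_block.
rewrite -natr1 mulrDl mul1r; apply: le_trans le_p _.
move: le_F le_u; lra.
Qed.

(** The lines through [v] correspond to the parallel classes, so [v] affects exactly one factor for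
    each variable [z a]. *)
Lemma prod_lines_split (v : V) (F : Lns -> R) :
  \prod_l F l = \prod_(l | ~~ inc v l) F l * \prod_a F (lam v a).
Proof.
rewrite (bigID (inc v)) /= mulrC; congr (_ * _).
rewrite (reindex_onto (lam v) cls) /=; last by move=> l; apply: lam_cls.
by apply: eq_bigl => a; rewrite inc_lam cls_lam eqxx.
Qed.

(** The reverse passage, from the root to the sequences of embedded points on each line. Each point
    takes an entry of a fresh block at which the expectation is at least the block average, so it
    loses at most [#|A| * eta]. *)
Lemma embed_points (r : seq V) : uniq r -> (size r * L <= size t)%N ->
  exists rho : V -> I,
  subseq (map rho r) (drop (size t - size r * L)%N t) /\
  avg (fun z => h z * \prod_l G [::] (z (cls l))) - (size r)%:R * (#|A|%:R * eta)
  <= avg (fun z => h z * \prod_l G [seq rho v | v <- r & inc v l] (z (cls l))).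
Proof.
elim: r => [|v r IHr] /=.
  by move=> _ _; exists (fun=> x0); rewrite sub0seq mul0r subr0.
move=> /andP[vr ur] le_rt; have [||rho [sub le_rho]] := IHr => //.
  by apply: leq_trans le_rt; rewrite leq_mul.
set k := (size t - size r * L)%N in sub.
have le_k : (L <= k <= size t)%N by rewrite leq_subr leq_subRL 1?addnC -?mulSn // (leq_trans _ le_rt) ?leq_mul.
pose us l := [seq rho v' | v' <- r & inc v' l].
(* The lines avoiding [v] are absorbed into the bounded function [f]; those through [v] are the
   factors to be extended. *)
pose f z := h z * \prod_(l | ~~ inc v l) G (us l) (z (cls l)).
have f1 z : `|f z| <= 1.
  rewrite normrM mulr_ile1 // prod_norm_le1 // => l.
  by have /andP[? ?] := G1 (us l) (z (cls l)); rewrite ger0_norm.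
have subus l : subseq (us l) (drop k t).
  by apply: subseq_trans sub; rewrite map_subseq // filter_subseq.
(* The line has [q] points and [v] is one of them, not yet embedded. *)
have szus a : (size (us (lam v a)) < q)%N.
  rewrite -(card_line (lam v a)) size_map cardE.
  have := @uniq_leq_size _ (v :: [seq v' <- r | inc v' (lam v a)])
    (enum [set v' | inc v' (lam v a)]); apply.
    by rewrite /= mem_filter (negPf vr) andbF filter_uniq.
  move=> v'; rewrite inE mem_enum inE => /orP[/eqP -> //|].
  by rewrite mem_filter => /andP[].
have := avg_extend le_k (fun a => subus (lam v a)) szus f1.
set F := fun p : 'I_L => _; rewrite ler_norml => /andP[le_F _].
have [|p le_p] := avg_max F; first by rewrite card_ord.
pose x := nth x0 t (k - L + p)%N.
pose rho' v' := if v' == v then x else rho v'.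
have map' r' : v \notin r' -> map rho' r' = map rho r'.
  move=> nv; apply/eq_in_map => v' v'r; rewrite /rho'.
  by case: eqP => // v'v; rewrite -v'v v'r in nv.
exists rho'; split.
  rewrite map' // /rho' eqxx mulSn (addnC L) subnDA.
  exact: nth_block.
have us'E l : [seq rho' v' | v' <- (if inc v l then v :: [seq v' <- r | inc v' l]
     else [seq v' <- r | inc v' l])] = if inc v l then x :: us l else us l.
  have nv : v \notin [seq v' <- r | inc v' l] by rewrite mem_filter (negPf vr) andbF.
  by case: ifP => _ /=; rewrite map' // /rho' eqxx.
have -> : avg (fun z => h z * \prod_l G [seq rho' v' | v' <-
     (if inc v l then v :: [seq v' <- r | inc v' l] else [seq v' <- r | inc v' l])] (z (cls l)))
   = F p.
  apply: eq_avg => z; rewrite /f -mulrA; congr (_ * _).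
  rewrite (prod_lines_split v); congr (_ * _).
    by apply: eq_bigr => l /negPf nvl; rewrite us'E nvl.
  by apply: eq_bigr => a _; rewrite us'E inc_lam cls_lam.
apply: le_trans le_p.
have -> : (size r).+1%:R = (size r)%:R + 1 :> R by rewrite natr1.
have eF : avg (fun z => f z * \prod_a G (us (lam v a)) (z a))
   = avg (fun z => h z * \prod_l G (us l) (z (cls l))).
  apply: eq_avg => z; rewrite (prod_lines_split v) mulrA; congr (_ * _).
  by apply: eq_bigr => a _; rewrite cls_lam.
move: le_F le_rho; rewrite eF -/us; lra.
Qed.

(** With [y] the product over [A] and [m = #|Lns|], each factor is at least [y], so the product over
    lines is at least [y ^+ m]. The pointwise bound [e ^+ m * (h z * y - e) <= h z * y ^+ m] is then
    averaged. *)
Lemma avg_pow_ge (e : R) : 0 <= e ->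
  e *+ 2 <= avg (fun z => h z * \prod_a G [::] (z a)) ->
  e ^+ #|Lns|.+1 <= avg (fun z => h z * \prod_l G [::] (z (cls l))).
Proof.
move=> e0 le_e; set m := #|Lns|.
apply: (@le_trans _ _ (avg (fun z => e ^+ m * (h z * \prod_a G [::] (z a) - e)))).
  rewrite avgZ exprSr ler_wpM2l ?exprn_ge0 // avgB.
  have : avg (fun _ : {ffun A -> X} => e) <= e by apply: avg_le.
  by move: le_e; rewrite mulr2n; lra.
apply: ler_avg => z; set y := \prod_a _.
have /andP[hz0 hz1] := h1 z.
have y0 : 0 <= y by apply: prodr_ge0 => a _; have /andP[] := G1 [::] (z a).
have y1 : y <= 1 by apply: prodr_ile1 => a _; exact: G1.
have le_y : y ^+ m <= \prod_l G [::] (z (cls l)).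
  rewrite /m -prodr_const; apply: ler_prod => l _; rewrite y0 /= /y (bigD1 (cls l)) //=.
  have /andP[? ?] := G1 [::] (z (cls l)).
  by rewrite ler_piMr // prodr_ile1.
apply: le_trans (ler_wpM2l hz0 le_y).
(* If [y < e], the left side is nonpositive; otherwise [e ^+ m <= y ^+ m] and
   [h z * y - e <= h z]. *)
have [le_ey|lt_ye] := lerP e y; last first.
  apply: (@le_trans _ _ 0); last by rewrite mulr_ge0 ?exprn_ge0.
  rewrite mulr_ge0_le0 ?exprn_ge0 // subr_le0 (le_trans _ (ltW lt_ye)) //.
  by rewrite ler_piMl // prodr_ge0.
apply: (@le_trans _ _ (h z * e ^+ m)); last first.
  by rewrite ler_wpM2l // lerXn2r ?nnegrE.
rewrite mulrC ler_wpM2r ?exprn_ge0 //.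
have : h z * y <= h z by rewrite ler_piMr.
by lra.
Qed.

End WeakLimitFamily.

(** Goes from length [q] down to the root, raises the density there to one factor per line, and goes
    up again while embedding the points. The constants [M] and [c] do not depend on [I], [X], [g] or
    [h], which makes averaging over samples possible. *)
Theorem dense_affine_embedding (e : R) : (0 < q)%N -> 0 < e ->
  exists M : nat, exists2 c : R, 0 < c &
  forall (I : eqType) (X : finType) (g : seq I -> X -> R) (s : seq I)
    (h : {ffun A -> X} -> R),
  uniq s -> (M <= size s)%N -> (forall u x, 0 <= g u x <= 1) ->
  (forall z, 0 <= h z <= 1) ->
  (forall u, subseq u s -> size u = q -> e <= avg (fun z => h z * \prod_a g u (z a))) ->
  exists2 rho : V -> I, injective rho &
    c <= avg (fun z => h z *
           \prod_l g [seq rho v | v <- enum V & inc v l] (z (cls l))).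
Proof.
(* [d] bounds the loss in each passage: [d <= e / 2] leaves [e / 2 = (e / 4) *+ 2] at the root, and
   [d <= c0 / 2] leaves [c0 / 2] at the end. [D] exceeds the number of replaced factors, and [L] is
   large enough that [L^-1 <= gam = eta ^+ 2 / 2]. *)
move=> q0 e0; pose c0 := (e / 4) ^+ #|Lns|.+1.
have c00 : 0 < c0 by rewrite exprn_gt0 // divr_gt0.
pose d := Num.min (e / 2) (c0 / 2).
have d0 : 0 < d by rewrite lt_min !divr_gt0.
pose D := ((q + #|V|) * #|A|).+1.
pose eta := d / D%:R.
have eta0 : 0 < eta by rewrite divr_gt0.
pose gam := eta ^+ 2 / 2.
have gam0 : 0 < gam by rewrite divr_gt0 // exprn_gt0.
pose L := (Num.truncn gam^-1).+1.
have le_L : L%:R^-1 + gam <= eta ^+ 2.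
  have : L%:R^-1 <= gam.
    by rewrite -[gam]invrK lef_pV2 ?posrE ?invr_gt0 // ltW // truncnS_gt.
  by rewrite /gam; lra.
have [M lims] := weak_limits q ((q + #|V|) * L) gam0.
exists M, (c0 / 2); first by rewrite divr_gt0.
move=> I X g s h us le_s g1 h1 dens.
have [t [G [sts le_t G1 Gg orth]]] := lims I X g s us le_s g1.
have [x0 _] : exists x0 : I, x0 \in t.
  case: t le_t {sts orth} => [|x0 t _]; last by exists x0; rewrite mem_head.
  by rewrite leqn0 muln_eq0 addn_eq0 -!leqn0 leqNgt q0.
have small j : (j <= q + #|V|)%N -> j%:R * (#|A|%:R * eta) <= d.
  move=> le_j; rewrite mulrA -natrM /eta mulrA ler_pdivrMr // mulrC ler_pM2l //.
  by rewrite ler_nat /D leqW // leq_mul.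
have qt : (q * L <= size t)%N by apply: leq_trans le_t; rewrite leq_mul // leq_addr.
have Vt : (size (enum V) * L <= size t)%N.
  by apply: leq_trans le_t; rewrite -cardE leq_mul // leq_addl.
have [u [szu subu le_u]] := avg_root_ge x0 (ltn0Sn _) (ltW eta0) (ltW gam0) le_L G1 orth h1 (leqnn q) qt.
have := dens u (subseq_trans (subseq_trans subu (drop_subseq _ _)) sts) szu.
rewrite -Gg // => le_e.
have root_ge : (e / 4) *+ 2 <= avg (fun z => h z * \prod_a G [::] (z a)).
  have := small q (leq_addr _ _).
  have : d <= e / 2 by rewrite ge_min lexx.
  by rewrite [_ / 4 *+ 2]mulr2n; move: le_e le_u; lra.
have pow_ge := avg_pow_ge G1 h1 (ltW (divr_gt0 e0 (ltr0Sn _ _))) root_ge.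
have [rho [sub le_rho]] := embed_points x0 (ltn0Sn _) (ltW eta0) (ltW gam0) le_L
  G1 orth h1 (enum_uniq V) Vt.
exists rho.
  apply/injectiveP.
  exact: subseq_uniq (subseq_trans sub (drop_subseq _ _)) (subseq_uniq sts us).
(* Once all points are embedded, every line carries a sequence of full length [q], where [G] is
   [g]. *)
have -> : avg (fun z => h z * \prod_l g [seq rho v | v <- enum V & inc v l] (z (cls l)))
  = avg (fun z => h z * \prod_l G [seq rho v | v <- enum V & inc v l] (z (cls l))).
  apply: eq_avg => z; congr (_ * _); apply: eq_bigr => l _; rewrite Gg //.
  rewrite size_map -(card_line l) cardE /enum_mem -filter_predI; congr size.
  by apply: eq_filter => v; rewrite !inE andbT.
apply: le_trans le_rho.
have := small _ (leq_addl q #|V|); rewrite -cardE.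
have : d <= c0 / 2 by rewrite ge_min lexx orbT.
move: pow_ge; rewrite -/c0; lra.
Qed.

End Embedding.

(** * Random maps, their restrictions, and counting bounds *)

Section Counting.
Variable R : realFieldType.
Implicit Types A X I V : finType.

Lemma avg_indicator X (b : pred X) :
  avg (fun x => (b x)%:R : R) = #|[set x | b x]|%:R / #|X|%:R.
Proof.
rewrite /avg; congr (_ / _); rewrite -sum1_card natr_sum big_mkcond /=.
by rewrite [RHS]big_mkcond; apply: eq_bigr => x _; rewrite inE; case: (b x).
Qed.

Lemma avg_sum X I (P : pred I) (F : I -> X -> R) :
  avg (fun x => \sum_(i | P i) F i x) = \sum_(i | P i) avg (F i).
Proof. by rewrite /avg exchange_big mulr_suml. Qed.

Lemma avg_prod_inj A I X (p : A -> I) (G : A -> X -> R) :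
  injective p -> (0 < #|X|)%N ->
  avg (fun T : {ffun I -> X} => \prod_a G a (T (p a))) = \prod_a avg (G a).
Proof.
move=> p_inj X0.
(* The factors are extended by [1] off the image of [p], so that [avg_prod] applies to all of
   [I]. *)
pose W i x := if [pick a | p a == i] is Some a then G a x else 1.
have Wp a : W (p a) = G a.
  rewrite /W; case: pickP => [a' /eqP /p_inj -> //|/(_ a)].
  by rewrite eqxx.
have prodW (F : I -> R) : (forall i, i \notin [set p a | a in A] -> F i = 1) ->
    \prod_i F i = \prod_a F (p a).
  move=> F1; rewrite (bigID (mem [set p a | a in A])) /= [X in _ * X]big1 // mulr1.
  rewrite big_imset /=; last by move=> a a' _ _; apply: p_inj.
  by apply: eq_bigl => a.
have W1 i x : i \notin [set p a | a in A] -> W i x = 1.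
  rewrite /W; case: pickP => // a /eqP <- /negP []; exact: imset_f.
transitivity (avg (fun T : {ffun I -> X} => \prod_i W i (T i))).
  apply: eq_avg => T; rewrite prodW; last by move=> i /W1.
  by apply: eq_bigr => a _; rewrite Wp.
rewrite avg_prod prodW => [|i /W1 Wi]; first by apply: eq_bigr => a _; rewrite Wp.
by rewrite (eq_avg Wi) avg_cst.
Qed.

(** Restricting a uniform map along an injection gives a uniform map. By linearity it suffices to
    treat point indicators, which are products over the coordinates. *)
Lemma avg_precomp A I X (p : A -> I) (F : {ffun A -> X} -> R) :
  injective p -> (0 < #|X|)%N ->
  avg (fun T : {ffun I -> X} => F [ffun a => T (p a)]) = avg F.
Proof.
move=> p_inj X0.
transitivity (avg (fun T : {ffun I -> X} =>
    \sum_psi F psi * \prod_a (T (p a) == psi a)%:R)).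
  apply: eq_avg => T; set psi0 := finfun _.
  rewrite (bigD1 psi0) //= big1 ?mulr1 => [|a _]; last by rewrite ffunE eqxx.
  rewrite big1 ?addr0 // => psi ne; apply/eqP; rewrite mulf_eq0; apply/orP; right.
  have [a ne_a] : exists a, T (p a) != psi a.
    apply/existsP; apply: contraNT ne => /existsPn eq_psi.
    by apply/eqP/ffunP => a; rewrite ffunE; apply/esym/eqP; rewrite -[_ == _]negbK eq_psi.
  by rewrite (bigD1 a) //= (negPf ne_a) mul0r.
rewrite avg_sum [RHS]/avg mulr_suml; apply: eq_bigr => psi _.
rewrite avgZ (avg_prod_inj (fun a x => (x == psi a)%:R) p_inj X0); congr (_ * _).
rewrite (eq_bigr (fun=> #|X|%:R^-1)) => [|a _]; last exact: avg_eq_delta.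
by rewrite prodr_const card_ffun natrX exprVn.
Qed.

Definition glue V X (P : pred V) (x0 : X) (f : {ffun {v | ~~ P v} -> X})
    (z : {ffun {v | P v} -> X}) : {ffun V -> X} :=
  [ffun v => if insub v is Some a then z a
             else if insub v is Some b then f b else x0].

Section Glue.
Variables (V X : finType) (P : pred V) (x0 : X).
Implicit Types (f : {ffun {v | ~~ P v} -> X}) (z : {ffun {v | P v} -> X}).

Lemma glue_in f z (a : {v | P v}) : glue x0 f z (val a) = z a.
Proof. by rewrite ffunE valK. Qed.

Lemma glue_out f z (b : {v | ~~ P v}) : glue x0 f z (val b) = f b.
Proof. by rewrite ffunE insubN ?valK // (valP b). Qed.

(** Gluing is a bijection from pairs of partial maps to maps, so a uniform map is an independent
    pair of uniform parts. *)
Lemma avg_glue (F : {ffun V -> X} -> R) :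
  avg F = avg (fun f => avg (fun z => F (glue x0 f z))).
Proof.
pose unglue (phi : {ffun V -> X}) : {ffun {v | ~~ P v} -> X} * {ffun {v | P v} -> X} :=
  ([ffun b => phi (val b)], [ffun a => phi (val a)]).
pose gl (fz : {ffun {v | ~~ P v} -> X} * {ffun {v | P v} -> X}) := glue x0 fz.1 fz.2.
have glueK : cancel gl unglue.
  move=> [f z]; rewrite /unglue /=; congr (_, _); apply/ffunP => v; rewrite ffunE.
    exact: glue_out.
  exact: glue_in.
have unglueK : cancel unglue gl.
  move=> phi; apply/ffunP => v; have [Pv|nPv] := boolP (P v).
    by rewrite /gl -[v](SubK {v | P v} Pv) glue_in ffunE.
  by rewrite /gl -[v](SubK {v | ~~ P v} nPv) glue_out ffunE.
rewrite /avg -mulr_suml pair_big /= -mulrA -invfM -natrM mulnC.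
congr (_ / _%:R); last by rewrite -card_prod (bij_eq_card (Bijective unglueK glueK)).
by rewrite (reindex gl) //; exists unglue => fz _.
Qed.

End Glue.

(** The last term bounds the number of non-injective maps from [q] points to [n] points. *)
Lemma expn_le_ffact (n q : nat) : (n ^ q <= n ^_ q + q ^ 2 * n ^ q.-1)%N.
Proof.
elim: q => [|q IHq]; first by rewrite expn0 ffactn0.
case: q IHq => [|q] IHq; first by rewrite ffactn1 expn1 leq_addr.
rewrite [q.+2.-1]/=.
have [le_qn|lt_nq] := leqP q.+1 n; last first.
  have -> : (n ^ q.+2 = n * n ^ q.+1)%N by rewrite -expnS.
  rewrite (leq_trans _ (leq_addl _ _)) // leq_mul // (leq_trans (ltnW lt_nq)) //.
  by rewrite (leq_trans (leqnSn _)) // expnS expn1 leq_pmulr.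
rewrite ffactnSr expnSr.
have le_ff : (n ^_ q.+1 <= n ^ q.+1)%N.
  by elim: (q.+1) => [|k IHk]; rewrite ?ffactn0 // ffactnSr expnSr leq_mul // leq_subr.
have e1 : (n ^_ q.+1 * n = n ^_ q.+1 * (n - q.+1) + n ^_ q.+1 * q.+1)%N.
  by rewrite -mulnDr subnK.
have : (n ^ q.+1 * n <= n ^_ q.+1 * n + q.+1 ^ 2 * n ^ q.+1.-1 * n)%N.
  by rewrite -mulnDl leq_mul2r IHq orbT.
have -> : (q.+1 ^ 2 * n ^ q.+1.-1 * n = q.+1 ^ 2 * n ^ q.+1)%N.
  by rewrite -mulnA -expnSr.
rewrite e1 -addnA => h; apply: leq_trans h _; rewrite leq_add2l.
apply: (@leq_trans (n ^ q.+1 * q.+1 + q.+1 ^ 2 * n ^ q.+1)%N).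
  by rewrite leq_add2r leq_mul2r le_ff orbT.
rewrite [(n ^ q.+1 * _)%N]mulnC -mulnDl leq_mul2r; apply/orP; right.
by rewrite !expnS expn0 !muln1 -mulSn leq_mul.
Qed.

(** A set in [low] has [q] elements, so at most [q ^ q] maps have it as image. *)
Lemma card_bad_maps X (q : nat) (low : {set {set X}}) :
  (forall Q, Q \in low -> #|Q| = q) ->
  (#|[set f : {ffun 'I_q -> X} | ~~ injectiveb f || ([set f i | i in 'I_q] \in low)]|
   <= q ^ 2 * #|X| ^ q.-1 + q ^ q * #|low|)%N.
Proof.
move=> lowq.
have -> : [set f : {ffun 'I_q -> X} | ~~ injectiveb f || ([set f i | i in 'I_q] \in low)]
   = [set f : {ffun 'I_q -> X} | ~~ injectiveb f] :|: [set f : {ffun 'I_q -> X} | [set f i | i in 'I_q] \in low].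
  by apply/setP => f; rewrite !inE.
apply: leq_trans (leq_card_setU _ _) _; apply: leq_add.
  have := cardsC [set f : {ffun 'I_q -> X} | injectiveb f].
  have -> : ~: [set f : {ffun 'I_q -> X} | injectiveb f] = [set f : {ffun 'I_q -> X} | ~~ injectiveb f].
    by apply/setP => f; rewrite !inE.
  rewrite card_inj_ffuns card_ffun !card_ord => eq_n.
  by rewrite -(leq_add2l (#|X| ^_ q)) eq_n expn_le_ffact.
rewrite -sum1_card (partition_big (fun f : {ffun 'I_q -> X} => [set f i | i in 'I_q])
  (mem low)) /= => [|f]; last by rewrite inE.
rewrite mulnC -sum_nat_const; apply: leq_sum => Q /lowq szQ.
rewrite sum1_card -[X in (_ <= X ^ _)%N]szQ -[X in (_ <= _ ^ X)%N]card_ord -card_ffun_on.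
apply: subset_leq_card; apply/subsetP => f; rewrite inE => /andP[_ /eqP fQ].
by apply/ffun_onP => i; rewrite -fQ imset_f.
Qed.

End Counting.

(** By uniformity, the members of [NH H Q] are singletons, so this neighbourhood of sets becomes one
    of vertices. *)
Lemma card_NH_le (n q : nat) (H : {set {set 'I_n}}) (Q : {set 'I_n}) :
  (forall e, e \in H -> #|e| = q.+1) -> #|Q| = q ->
  (#|NH H Q| <= #|[set x | (x |: Q) \in H]|)%N.
Proof.
move=> Hq szQ.
apply: leq_trans (leq_imset_card (fun x => [set x]) _).
apply/subset_leq_card/subsetP => T; rewrite inE => /andP[dTQ QT].
have : #|T| == 1.
  have := cardsUI Q T; rewrite (Hq _ QT) setIC (disjoint_setI0 dTQ) cards0 addn0 szQ.
  by rewrite -addn1 => /eqP; rewrite eqn_add2l eq_sym.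
move=> /cards1P[x eT]; rewrite eT; apply: imset_f.
by rewrite inE setUC -eT.
Qed.

Lemma card_sets_le_maps (A X : finType) (S : {set {set X}}) :
  (forall e, e \in S -> #|e| = #|A|) ->
  (#|S| <= #|[set z : {ffun A -> X} | [set z a | a in A] \in S]|)%N.
Proof.
move=> SA; set Zs := finset _.
apply: leq_trans (leq_imset_card (fun z : {ffun A -> X} => [set z a | a in A]) Zs).
apply/subset_leq_card/subsetP => e eS.
pose z := [ffun a : A => enum_val (cast_ord (esym (SA e eS)) (enum_rank a))].
suff ze : [set z a | a in A] = e by apply/imsetP; exists z => //; rewrite inE ze.
apply/eqP; rewrite eqEcard; apply/andP; split.
  by apply/subsetP => x /imsetP[a _ ->]; rewrite ffunE enum_valP.
rewrite card_imset ?SA // => a b; rewrite !ffunE => /enum_val_inj /cast_ord_inj.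
exact: enum_rank_inj.
Qed.

Lemma homdensE (R : realFieldType) (V : finType) (EF : {set {set V}}) (n : nat)
    (H : {set {set 'I_n}}) :
  homdens R EF H = avg (fun phi : {ffun V -> 'I_n} =>
    [forall e in EF, (phi @: e) \in H]%:R).
Proof. by rewrite avg_indicator card_ffun card_ord. Qed.

(** * Projective planes with a line at infinity *)

Section LinearSpace.
(** The incidence axioms of a projective plane of order [q]. [E0] is the line at infinity with point
    set [A]; [B] and [Lns] are the affine points and lines. *)
Variables (V : finType) (EF : {set {set V}}) (E0 : {set V}) (q : nat).
Hypothesis E0_EF : E0 \in EF.
Hypothesis card_edge : forall e, e \in EF -> #|e| = q.+1.
Hypothesis card_meet : forall e e', e \in EF -> e' \in EF -> e != e' -> #|e :&: e'| = 1%N.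
Hypothesis join_edge : forall v w, v != w -> exists2 e, e \in EF & (v \in e) && (w \in e).
Hypothesis q_gt0 : (0 < q)%N.

Let A : finType := {v | v \in E0}.
Let B : finType := {v | v \notin E0}.
Let Lns : finType := {e | (e \in EF) && (e != E0)}.
Let inc (v : B) (l : Lns) := val v \in val l.

Lemma meet_unique e e' x y : e \in EF -> e' \in EF -> e != e' ->
  x \in e -> x \in e' -> y \in e -> y \in e' -> x = y.
Proof.
move=> eF e'F ne xe xe' ye ye'; have /eqP/cards1P[w ew] := card_meet eF e'F ne.
have : x \in e :&: e' by rewrite inE xe.
have : y \in e :&: e' by rewrite inE ye.
by rewrite ew !inE => /eqP -> /eqP ->.
Qed.

Lemma line_at_infinity_point (l : Lns) : exists a : A, val a \in val l.
Proof.
have /andP[lF ne] := valP l; have /eqP/cards1P[w ew] := card_meet lF E0_EF ne.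
have : w \in val l :&: E0 by rewrite ew inE.
by rewrite inE => /andP[wl w0]; exists (Sub w w0).
Qed.

Lemma line_through (v : B) (a : A) : exists l : Lns, inc v l && (val a \in val l).
Proof.
have ne : val v != val a by apply: contraNneq (valP v) => ->; exact: valP a.
have [e eF /andP[ve ae]] := join_edge ne.
have neE : e != E0 by apply: contraNneq (valP v) => eE; move: ve; rewrite eE.
have eL : (e \in EF) && (e != E0) by rewrite eF.
by exists (Sub e eL); rewrite /inc /= ve ae.
Qed.

Let cls (l : Lns) : A := xchoose (line_at_infinity_point l).
Let lam (v : B) (a : A) : Lns := xchoose (line_through v a).

Let cls_in l : val (cls l) \in val l.
Proof. exact: (xchooseP (line_at_infinity_point l)). Qed.

Let lam_in v a : inc v (lam v a) /\ val a \in val (lam v a).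
Proof. by have /andP := xchooseP (line_through v a). Qed.

Let cls_lam v a : cls (lam v a) = a.
Proof.
have [_ al] := lam_in v a; have /andP[lF ne] := valP (lam v a).
apply: val_inj; apply: (meet_unique lF E0_EF ne) => //; exact: valP.
Qed.

Let lam_cls v l : inc v l -> lam v (cls l) = l.
Proof.
move=> vl; have [vl' cl'] := lam_in v (cls l); apply: val_inj.
have /andP[lF _] := valP l; have /andP[l'F _] := valP (lam v (cls l)).
apply/eqP; apply: contraT => ne.
have eq_vc := meet_unique l'F lF ne vl' vl cl' (cls_in l).
by have := valP v; rewrite eq_vc (valP (cls l)).
Qed.

Let card_line (l : Lns) : #|[set v | inc v l]| = q.
Proof.
have /andP[lF ne] := valP l.
rewrite -(card_imset _ val_inj) /=.
have -> : [set val v | v in [set v | inc v l]] = val l :\: E0.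
  apply/setP => v; apply/imsetP/idP => [[w]|].
    by rewrite inE => wl ->; rewrite inE (valP w).
  by rewrite inE => /andP[v0 vl]; exists (Sub v v0); rewrite ?inE /inc.
by rewrite cardsD card_meet // card_edge // subn1.
Qed.

Let card_A : #|A| = q.+1.
Proof. by rewrite card_sig -(card_edge E0_EF); apply: eq_card. Qed.

(** * Copies of the plane in the host hypergraph *)

Section Host.
Variables (R : archiRealFieldType) (n : nat) (H : {set {set 'I_n}}).
Hypothesis n_gt0 : (0 < n)%N.
Hypothesis H_unif : forall e, e \in H -> #|e| = q.+1.

Let h (z : {ffun A -> 'I_n}) : R := ([set z a | a in A] \in H)%:R.

(** The neighbourhood [Z] of [Q] is larger than [(delta - eps) * n], so by assumption it is not
    sparse. As [#|Z|] is at least [eps * n], it spans at least [eps ^+ q.+2 / (q.+1)! * n ^+ q.+1]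
    edges, each the image of some map [z]. *)
Lemma dense_link (eps delta : R) (Q : {set 'I_n}) : 0 < eps < delta ->
  ~ (exists Z : {set 'I_n}, (delta - eps) * n%:R < #|Z|%:R /\
        dens R q.+1 #|Z| (induced H Z) < eps) ->
  #|Q| = q -> Q \notin lowdeg q H delta ->
  eps ^+ q.+2 / (q.+1)`!%:R <=
    avg (fun z => h z * \prod_a ((z a |: Q) \in H)%:R).
Proof.
move=> /andP[eps0 lt_eps] noZ szQ.
rewrite inE szQ eqxx /= -leNgt => deg.
pose Z := [set x | (x |: Q) \in H].
have n0 : 0 < n%:R :> R by rewrite ltr0n.
have leZ : delta * n%:R <= #|Z|%:R.
  by apply: le_trans deg _; rewrite ler_nat; exact: card_NH_le H_unif szQ.
have epsZ : eps * n%:R <= #|Z|%:R.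
  by apply: le_trans leZ; rewrite ler_wpM2r // ltW.
have Z0 : 0 < #|Z|%:R :> R by apply: lt_le_trans epsZ; rewrite mulr_gt0.
have densZ : eps <= dens R q.+1 #|Z| (induced H Z).
  rewrite leNgt; apply/negP => lt_dens; apply: noZ; exists Z; split=> //.
  by apply: lt_le_trans leZ; rewrite ltr_pM2r // gtrBl.
have card_ind : eps ^+ q.+2 / (q.+1)`!%:R * n%:R ^+ q.+1 <= #|induced H Z|%:R.
  move: densZ; rewrite /dens natrX ler_pdivlMr ?exprn_gt0 // natrM => densZ.
  have f0 : 0 < (q.+1)`!%:R :> R by rewrite ltr0n fact_gt0.
  rewrite mulrAC ler_pdivrMr // [_ * _`!%:R]mulrC (le_trans _ densZ) //.
  rewrite exprS -mulrA ler_wpM2l ?(ltW eps0) // -exprMn.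
  by apply: lerXn2r; rewrite ?nnegrE // mulr_ge0 // ltW.
have -> : avg (fun z => h z * \prod_a ((z a |: Q) \in H)%:R) =
    avg (fun z : {ffun A -> 'I_n} => ([set z a | a in A] \in induced H Z)%:R : R).
  apply: eq_avg => z; rewrite inE /h; case: (_ \in H); rewrite ?mul0r // mul1r /=.
  have [sub|nsub] := boolP (_ \subset Z).
    rewrite big1 // => a _; have := subsetP sub (z a).
    by rewrite imset_f // inE => ->.
  have [x /imsetP[a _ ->] nza] := subsetPn nsub.
  by rewrite inE in nza; rewrite (bigD1 a) //= (negPf nza) mul0r.
rewrite avg_indicator card_ffun card_A card_ord natrX ler_pdivlMr ?exprn_gt0 //.
apply: le_trans card_ind _; rewrite ler_nat.
apply: card_sets_le_maps => e; rewrite inE card_A => /andP[eH _]; exact: H_unif.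
Qed.

Let Psi (f : {ffun B -> 'I_n}) : R :=
  avg (fun z => h z * \prod_l ((z (cls l) |: [set f v | v in [set v | inc v l]]) \in H)%:R).

(** Pointwise: if the glued map misses an edge of [H], then either [E0] is at fault and [h z = 0],
    or an affine line is and its factor vanishes. *)
Lemma avg_Psi_le : avg Psi <= homdens R EF H.
Proof.
pose x0 : 'I_n := Ordinal n_gt0.
have -> : homdens R EF H = avg (fun f : {ffun B -> 'I_n} =>
    avg (fun z : {ffun A -> 'I_n} => [forall e in EF, glue x0 f z @: e \in H]%:R)).
  by rewrite homdensE (avg_glue (fun v => v \in E0) x0).
apply: ler_avg => f; apply: ler_avg => z.
have [hom|nhom] := boolP [forall e in EF, glue x0 f z @: e \in H].
  by rewrite mulr_ile1 ?ler0n ?lern1 ?leq_b1 ?prodr_ge0 ?prodr_ile1 // => l _;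
     rewrite ?ler0n ?lern1 ?leq_b1.
have [e eF ne] : exists2 e, e \in EF & glue x0 f z @: e \notin H.
  move: nhom; rewrite negb_forall => /existsP[e]; rewrite negb_imply => /andP[? ?].
  by exists e.
have [eE0|neE0] := eqVneq e E0.
  suff im : [set z a | a in A] = glue x0 f z @: e by rewrite /h im (negPf ne) mul0r.
  apply/setP => x; apply/imsetP/imsetP => [[a _ ->]|[v]].
    by exists (val a); rewrite ?glue_in // eE0 (valP a).
  by rewrite eE0 => v0 ->; exists (Sub v v0) => //; rewrite -(glue_in x0 f z).
have eL : (e \in EF) && (e != E0) by rewrite eF.
pose l : Lns := Sub e eL.
rewrite (bigD1 l) //=.
suff im : (z (cls l) |: [set f v | v in [set v | inc v l]]) = glue x0 f z @: e.
  by rewrite im (negPf ne) mul0r mulr0.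
apply/setP => x; apply/idP/imsetP => [|[v ve ->]].
  rewrite in_setU1 => /orP[/eqP ->|/imsetP[v]].
    by exists (val (cls l)); [exact: (cls_in l) | rewrite glue_in].
  by rewrite inE => vl ->; exists (val v); rewrite ?glue_out.
have [v0|v0] := boolP (v \in E0).
  have -> : v = val (cls l).
    exact: (meet_unique eF E0_EF neE0 ve v0 (cls_in l) (valP (cls l))).
  by rewrite glue_in setU11.
rewrite -[v](SubK B v0) glue_out in_setU1 imset_f ?orbT // inE.
by rewrite /inc SubK.
Qed.

(** [T] is the vertex sample and [g u] the indicator of the neighbourhood of the image of [u] under
    [T]. The last hypothesis makes the image of each [q]-subset a [q]-set outside [lowdeg], so its
    link is dense and the embedding applies. *)
Lemma exists_dense_Psi (e c delta : R) (M : nat) (T : {ffun 'I_M -> 'I_n}) :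
  (forall (g : seq 'I_M -> 'I_n -> R) (s : seq 'I_M)  (h : {ffun A -> 'I_n} -> R),
    uniq s -> (M <= size s)%N -> (forall u x, 0 <= g u x <= 1) ->
    (forall z, 0 <= h z <= 1) ->
    (forall u, subseq u s -> size u = q -> e <= avg (fun z => h z * \prod_a g u (z a))) ->
    exists2 rho : B -> 'I_M, injective rho &
    c <= avg (fun z => h z *
           \prod_l g [seq rho v | v <- enum B & inc v l] (z (cls l)))) ->
  (forall Q : {set 'I_n}, #|Q| = q -> Q \notin lowdeg q H delta ->
    e <= avg (fun z => h z * \prod_a ((z a |: Q) \in H)%:R)) ->
  (forall r : {ffun 'I_q -> 'I_M}, injectiveb r ->
     let f := [ffun i => T (r i)] in
     injectiveb f && ([set f i | i in 'I_q] \notin lowdeg q H delta)) ->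
  exists2 rho : {ffun B -> 'I_M}, injectiveb rho & c <= Psi [ffun v => T (rho v)].
Proof.
move=> embed link good.
have ind1 (b : bool) : 0 <= (b%:R : R) <= 1 by case: b; rewrite ?lexx ler01.
pose g (u : seq 'I_M) (x : 'I_n) : R := ((x |: [set T i | i in u]) \in H)%:R.
have [||||u sub szu|rho rho_inj le_c] := embed g (enum 'I_M) h.
- exact: enum_uniq.
- by rewrite size_enum_ord.
- by move=> u x; exact: ind1.
- by move=> z; exact: ind1.
- have uu : uniq u := subseq_uniq sub (enum_uniq _).
  pose tu : q.-tuple 'I_M := Tuple (introT eqP szu).
  pose r := [ffun i => tnth tu i].
  have rb : injectiveb r.
    by apply/injectiveP => i j; rewrite !ffunE; apply/tuple_uniqP.
  have /andP[/injectiveP f_inj nlow] := good r rb.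
  have im : [set [ffun i => T (r i)] i | i in 'I_q] = [set T i | i in u].
    apply/setP => x; apply/imsetP/imsetP => [[i _ ->]|[j ju ->]].
      by exists (r i); rewrite !ffunE ?mem_tnth // (mem_tnth i tu).
    have /tnthP[i ji] : j \in tu by [].
    by exists i => //; rewrite !ffunE ji.
  rewrite im in nlow; apply: link nlow.
  by rewrite -im card_imset // card_ord.
exists (finfun rho); first by apply/injectiveP => v w; rewrite !ffunE => /rho_inj.
suff -> : Psi [ffun v => T (finfun rho v)] = avg (fun z => h z *
    \prod_l g [seq rho v | v <- enum B & inc v l] (z (cls l))) by [].
apply: eq_avg => z; congr (_ * _); apply: eq_bigr => l _; rewrite /g.
suff -> : [set [ffun v => T (finfun rho v)] v | v in [set v | inc v l]] =
    [set T i | i in [seq rho v | v <- enum B & inc v l]] by [].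
apply/esym/setP => x.
apply/imsetP/imsetP => [[i /mapP[v]]|[v]].
  rewrite mem_filter => /andP[vl _] -> ->; exists v; rewrite ?inE //.
  by rewrite !ffunE.
rewrite inE => vl ->; exists (rho v); last by rewrite !ffunE.
by apply/mapP; exists v; rewrite // mem_filter vl mem_enum.
Qed.

End Host.


Lemma avg_bad_maps (R : realFieldType) (n : nat) (low : {set {set 'I_n}}) :
  (0 < n)%N -> (forall Q, Q \in low -> #|Q| = q) ->
  avg (fun f : {ffun 'I_q -> 'I_n} =>
    (~~ (injectiveb f && ([set f i | i in 'I_q] \notin low)))%:R : R)
  <= (q ^ 2)%:R / n%:R + (q ^ q)%:R * dens R q n low.
Proof.
move=> n0 lowq; have n0R : 0 < n%:R :> R by rewrite ltr0n.
rewrite avg_indicator card_ffun !card_ord natrX ler_pdivrMr ?exprn_gt0 //.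
have := card_bad_maps lowq; rewrite card_ord.
have -> : [set f : {ffun 'I_q -> 'I_n} | ~~ injectiveb f || ([set f i | i in 'I_q] \in low)]
  = [set f : {ffun 'I_q -> 'I_n} | ~~ (injectiveb f && ([set f i | i in 'I_q] \notin low))].
  by apply/setP => f; rewrite !inE negb_and negbK.
rewrite -(ler_nat R) natrD !natrM => le_bad. apply: le_trans le_bad _.
rewrite mulrDl lerD //.
  by rewrite -(prednK q_gt0) natrX exprS !mulrA divfK ?gt_eqF.
rewrite -mulrA ler_wpM2l ?ler0n // /dens natrX divfK ?expf_neq0 ?gt_eqF //.
by rewrite ler_nat leq_pmull // fact_gt0.
Qed.

Theorem linear_space_dense_set (R : archiRealFieldType) (eps : R) : 0 < eps ->
  exists2 th0 : R, 0 < th0 & forall th : R, 0 < th < th0 ->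
  exists n0 : nat, forall n : nat, (n0 <= n)%N ->
  forall delta : R, 0 < delta < 1 ->
  forall H : {set {set 'I_n}},
    (forall e, e \in H -> #|e| = q.+1) ->
    homdens R EF H < th ->
    dens R q n (lowdeg q H delta) < th ->
    exists Z : {set 'I_n},
      (delta - eps) * n%:R < #|Z|%:R /\ dens R q.+1 #|Z| (induced H Z) < eps.
Proof.
move=> eps0; pose e : R := eps ^+ q.+2 / (q.+1)`!%:R.
have e0 : 0 < e by rewrite divr_gt0 ?exprn_gt0 // ltr0n fact_gt0.
have [M [c c0 embed]] := dense_affine_embedding (fun v a => proj1 (lam_in v a))
  cls_lam lam_cls card_line q_gt0 e0.
pose k1 := (M ^ #|B|)%N; pose k2 := (M ^ q * q ^ q)%N.
(* [k1] bounds the number of injections of [B] into the sample, and the final contradiction reads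
   [c / 2 <= k1 * th < c / 4]. The bound with [k2] and the choice of [n0] each keep one half of the
   failure probability of a sample below [1 / 4]. *)
exists (Num.min (c / (4 * k1.+1%:R)) (1 / (4 * k2.+1%:R))).
  by rewrite lt_min !divr_gt0 // mulr_gt0.
move=> th /andP[th0]; rewrite lt_min => /andP[th_k1 th_k2].
exists (4 * (q ^ 2 * M ^ q)).+1 => n le_n delta /andP[delta0 delta1] H Hu homH lowH.
have n_gt0 : (0 < n)%N by apply: leq_trans le_n.
have n0R : 0 < n%:R :> R by rewrite ltr0n.
(* A single vertex suffices when [delta <= eps]: it spans no edge, as edges have at least two
   vertices. *)
have [le_de|lt_ed] := lerP delta eps.
  exists [set Ordinal n_gt0]; rewrite cards1; split.
    by apply: (@le_lt_trans _ _ 0) => //; rewrite mulr_le0_ge0 ?subr_le0 // ltW.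
  suff -> : induced H [set Ordinal n_gt0] = set0 by rewrite /dens cards0 muln0 mul0r.
  apply/setP => E; rewrite !inE; apply/negP => /andP[EH].
  by move=> /subset_leq_card; rewrite cards1 (Hu _ EH) ltnNge q_gt0.
have [Z /andP[? ?]|noZ] := pickP (fun Z : {set 'I_n} =>
  ((delta - eps) * n%:R < #|Z|%:R) && (dens R q.+1 #|Z| (induced H Z) < eps)).
  by exists Z.
exfalso.
have link (Q : {set 'I_n}) : #|Q| = q -> Q \notin lowdeg q H delta ->
    e <= avg (fun z : {ffun A -> 'I_n} => ([set z a | a in A] \in H)%:R
      * \prod_a ((z a |: Q) \in H)%:R).
  move=> szQ nlow; apply: dense_link szQ nlow => //; first by rewrite eps0.
  by case=> Z [Z1 Z2]; have := noZ Z; rewrite Z1 Z2.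
pose ok (f : {ffun 'I_q -> 'I_n}) :=
  injectiveb f && ([set f i | i in 'I_q] \notin lowdeg q H delta).
pose good (T : {ffun 'I_M -> 'I_n}) :=
  [forall r : {ffun 'I_q -> 'I_M}, injectiveb r ==> ok [ffun i => T (r i)]].
pose Psi (f : {ffun B -> 'I_n}) : R :=
  avg (fun z : {ffun A -> 'I_n} => ([set z a | a in A] \in H)%:R
    * \prod_l ((z (cls l) |: [set f v | v in [set v | inc v l]]) \in H)%:R).
have I0 : (0 < #|'I_n|)%N by rewrite card_ord.
have T0 : (0 < #|{ffun 'I_M -> 'I_n}|)%N by rewrite card_ffun card_ord expn_gt0 n_gt0.
have Psi0 f : 0 <= Psi f.
  by apply: avg_ge0 => z; rewrite mulr_ge0 ?ler0n ?prodr_ge0.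
have dens0 : 0 <= dens R q n (lowdeg q H delta) by rewrite /dens divr_ge0.
(* Union bound over the injections [r]; by [avg_precomp] each term is the failure probability of a
   uniform map from ['I_q]. *)
have bad_le : avg (fun T => (~~ good T)%:R : R) <= 2^-1.
  apply: (@le_trans _ _ (\sum_(r : {ffun 'I_q -> 'I_M} | injectiveb r)
      avg (fun T : {ffun 'I_M -> 'I_n} => (~~ ok [ffun i => T (r i)])%:R))).
    rewrite -avg_sum; apply: ler_avg => T.
    have [_|] := boolP (good T); first by rewrite sumr_ge0.
    rewrite negb_forall => /existsP[r]; rewrite negb_imply => /andP[r_inj nok].
    by rewrite (bigD1 r) //= nok lerDl sumr_ge0.
  apply: (@le_trans _ _ ((M ^ q)%:R * ((q ^ 2)%:R / n%:R
      + (q ^ q)%:R * dens R q n (lowdeg q H delta)))).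
    apply: (@le_trans _ _ (\sum_(r : {ffun 'I_q -> 'I_M} | injectiveb r)
      ((q ^ 2)%:R / n%:R + (q ^ q)%:R * dens R q n (lowdeg q H delta)))).
      apply: ler_sum => r /injectiveP r_inj.
      rewrite (avg_precomp (fun f => (~~ ok f)%:R) r_inj I0).
      by apply: avg_bad_maps => // Q; rewrite inE => /andP[/eqP].
    rewrite sumr_const -[X in X <= _]mulr_natl ler_wpM2r //.
      by rewrite addr_ge0 ?divr_ge0 ?ler0n // mulr_ge0.
    by rewrite ler_nat -[X in (_ <= _ ^ X)%N]card_ord -[X in (_ <= X ^ _)%N]card_ord
      -card_ffun max_card.
  have b1 : (M ^ q)%:R * ((q ^ 2)%:R / n%:R) <= 4^-1 :> R.
    have : (4 * (q ^ 2 * M ^ q))%:R <= n%:R :> R by rewrite ler_nat ltnW.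
    rewrite mulrA ler_pdivrMr // natrM [X in _ * X]natrM.
    set x := (q ^ 2)%:R; set y := (M ^ q)%:R; lra.
  have b2 : (M ^ q)%:R * ((q ^ q)%:R * dens R q n (lowdeg q H delta)) <= 4^-1 :> R.
    rewrite mulrA -natrM -/k2; apply: (@le_trans _ _ (k2.+1%:R * th)).
      by apply: ler_pM; rewrite ?ler_nat // ltW.
    move: th_k2; rewrite ltr_pdivlMr ?mulr_gt0 //; set x := k2.+1%:R; lra.
  rewrite mulrDr; move: b1 b2; lra.
have half_le : c / 2 <= avg (fun T => c * (good T)%:R).
  have -> : avg (fun T => c * (good T)%:R) = c * (1 - avg (fun T => (~~ good T)%:R)).
    rewrite -[X in X - avg _](avg_cst 1 T0) -avgB avgZ; congr (_ * _); apply: eq_avg => T.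
    by case: (good T); rewrite ?subr0 ?subrr.
  by rewrite ler_pM2l //; move: bad_le; lra.
(* A good sample has some [rho] with value at least [c]. Summing over all [rho] removes the
   dependence of [rho] on [T], and each summand averages to [avg Psi]. *)
have : c / 2 <= k1%:R * avg Psi.
  apply: le_trans half_le _.
  apply: (@le_trans _ _ (\sum_(rho : {ffun B -> 'I_M} | injectiveb rho)
      avg (fun T : {ffun 'I_M -> 'I_n} => Psi [ffun v => T (rho v)]))).
    rewrite -avg_sum; apply: ler_avg => T; have [gT|_] := boolP (good T); last first.
      by rewrite mulr0 sumr_ge0.
    have [|rho rho_inj le_c] := exists_dense_Psi (embed _ _) link (T := T).
      by move=> r r_inj; have /forallP/(_ r) := gT; rewrite r_inj.
    rewrite mulr1 (bigD1 rho) //=; apply: le_trans le_c _.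
    by rewrite lerDl sumr_ge0.
  rewrite (eq_bigr (fun=> avg Psi)) => [|rho /injectiveP rho_inj]; last first.
    exact: avg_precomp.
  rewrite sumr_const -[X in X <= _]mulr_natl ler_wpM2r ?avg_ge0 //.
  by rewrite ler_nat /k1 -[X in (_ <= X ^ _)%N]card_ord -card_ffun max_card.
have := avg_Psi_le R H n_gt0; rewrite -/Psi => le_Psi.
move: th_k1; rewrite ltr_pdivlMr ?mulr_gt0 // -natr1 => th_k1 c2.
have : k1%:R * avg Psi <= k1%:R * th by rewrite ler_wpM2l // (le_trans le_Psi) // ltW.
move: th_k1 c2 th0; set a := k1%:R * avg Psi; set b := k1%:R; lra.
Qed.

End LinearSpace.

(** * Incidence axioms for the plane over a finite field *)

Section ProjectivePlane.
Variable K : finFieldType.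
Implicit Types (P : PGpoint K) (L : PGline K).

Let points_on L : {set PGpoint K} := [set P : PGpoint K | (val P <= val L)%MS].

Lemma card_row_space (m n : nat) (A : 'M[K]_(m, n)) :
  #|[set v : 'rV_n | (v <= A)%MS]| = (#|K| ^ \rank A)%N.
Proof.
have -> : [set v : 'rV_n | (v <= A)%MS] =
    [set w *m row_base A | w in [set: 'rV_(\rank A)]].
  apply/setP => v; rewrite inE -(eq_row_base A).
  apply/submxP/imsetP => [[w ->]|[w _ ->]]; first by exists w; rewrite ?inE.
  by exists w.
rewrite card_imset ?cardsT ?card_mx ?mul1n //.
exact: row_free_inj (row_base_free A).
Qed.

(** [<<A>>] is canonical for its row space, so equality of subspaces becomes equality of
    matrices. *)
Lemma genmx_fixed_eq (n : nat) (A B : 'M[K]_n) :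
  <<A>>%MS = A -> <<B>>%MS = B -> (A <= B)%MS -> \rank A = \rank B -> A = B.
Proof.
move=> gA gB AB rAB; rewrite -gA -gB; apply/genmxP; rewrite AB /=.
by rewrite -(geq_leqif (mxrank_leqif_sup AB)) rAB.
Qed.

Lemma point_of (A : 'M[K]_3) : \rank A = 1%N ->
  exists P, val P = <<A>>%MS.
Proof.
move=> rA; have PA : (<<<<A>>%MS>>%MS == <<A>>%MS) && (\rank <<A>> == 1)%N.
  by rewrite genmx_id eqxx mxrank_gen rA.
by exists (Sub <<A>>%MS PA).
Qed.

Lemma line_of (A : 'M[K]_3) : \rank A = 2%N ->
  exists L, val L = <<A>>%MS.
Proof.
move=> rA; have LA : (<<<<A>>%MS>>%MS == <<A>>%MS) && (\rank <<A>> == 2)%N.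
  by rewrite genmx_id eqxx mxrank_gen rA.
by exists (Sub <<A>>%MS LA).
Qed.

Lemma PGpointP P : <<val P>>%MS = val P /\ \rank (val P) = 1%N.
Proof. by have /andP[/eqP ? /eqP] := valP P. Qed.

Lemma PGlineP L : <<val L>>%MS = val L /\ \rank (val L) = 2%N.
Proof. by have /andP[/eqP ? /eqP] := valP L. Qed.

Lemma PGpoint_sub_eq P P' : (val P <= val P')%MS -> P = P'.
Proof.
have [gP rP] := PGpointP P; have [gP' rP'] := PGpointP P'.
by move=> sub; apply/val_inj/genmx_fixed_eq => //; rewrite rP rP'.
Qed.

(** The nonzero vectors of the line are partitioned by their spans into its points, so [q ^ 2 - 1]
    equals [q - 1] times the number of points. *)
Lemma card_points_on L : #|points_on L| = #|K|.+1.
Proof.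
have [_ rL] := PGlineP L.
have K1 : (1 < #|K|)%N := finNzRing_gt1 K.
pose nz (A : 'M[K]_3) := [set v : 'rV[K]_3 | (v <= A)%MS & v != 0].
have card_nz A : #|nz A| = (#|K| ^ \rank A).-1.
  rewrite -card_row_space [in RHS](cardsD1 0) inE sub0mx /=; apply: eq_card => v.
  by rewrite !inE andbC.
have : #|nz (val L)| = (\sum_(P in points_on L) #|nz (val P)|)%N.
  rewrite -sum1_card.
  have point_ex (v : 'rV[K]_3) : v != 0 -> exists P, (val P :=: v)%MS.
    move=> v0; pose A := <<v>>%MS.
    have rA : \rank A = 1%N by rewrite /A mxrank_gen rank_rV v0.
    have [P eP] := point_of rA; exists P; rewrite eP.
    exact: eqmx_trans (genmxE _) (genmxE _).
  have [P0 _] : exists P0 : PGpoint K, true.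
    have [|P _] := point_ex (delta_mx 0 0); last by exists P.
    by apply/eqP => /matrixP/(_ 0 0)/eqP; rewrite !mxE /= oner_eq0.
  pose pt (v : 'rV[K]_3) := odflt P0 [pick P : PGpoint K | (v <= val P)%MS].
  have ptE v P : v != 0 -> (v <= val P)%MS -> pt v = P.
    move=> v0 vP; rewrite /pt; case: pickP => [P' vP' /=|/(_ P)]; last by rewrite vP.
    have [Q eQ] := point_ex v v0.
    have -> : P' = Q by apply/esym/PGpoint_sub_eq; rewrite eQ.
    by apply: PGpoint_sub_eq; rewrite eQ.
  rewrite (partition_big pt (mem (points_on L))) /= => [|v]; last first.
    rewrite inE => /andP[vL v0]; have [Q eQ] := point_ex v v0.
    by rewrite (ptE v Q) ?eQ // inE eQ.
  apply: eq_bigr => P; rewrite inE => PL; rewrite sum1_card; apply: eq_card => v.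
  rewrite -topredE /= !inE; have [->|v0] := eqVneq v 0; first by rewrite !andbF.
  rewrite !andbT; apply/andP/idP => [[vL /eqP <-]|vP].
    have [Q eQ] := point_ex v v0; rewrite (ptE v Q) ?eQ //.
  by split; [apply: submx_trans vP PL | apply/eqP/ptE].
rewrite card_nz rL (eq_bigr (fun=> #|K|.-1)) => [|P _]; last first.
  by rewrite card_nz (PGpointP P).2 expn1.
rewrite sum_nat_const => eq_card.
have K0 : (0 < #|K|.-1)%N by rewrite -ltnS prednK // ltnW.
apply/eqP; rewrite -(eqn_pmul2r K0) -eq_card.
by rewrite -!subn1 -[X in (_ - X)%N](exp1n 2) subn_sqr addn1 mulnC.
Qed.

Lemma PG2_card_edge e : e \in PG2_edges K -> #|e| = #|K|.+1.
Proof. by case/imsetP => L _ ->; exact: card_points_on. Qed.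

(** The ranks of sum and intersection add up to [4]. The sum has rank at most [3], and the
    intersection has rank below [2] because the lines differ. *)
Lemma PG2_card_meet e e' : e \in PG2_edges K -> e' \in PG2_edges K -> e != e' ->
  #|e :&: e'| = 1%N.
Proof.
case/imsetP => L _ -> /imsetP[L' _ ->] ne.
have [gL rL] := PGlineP L; have [gL' rL'] := PGlineP L'.
have rcap : \rank (val L :&: val L')%MS = 1%N.
  have := mxrank_sum_cap (val L) (val L'); rewrite rL rL'.
  have := rank_leq_row (val L + val L')%MS.
  have : (\rank (val L :&: val L')%MS < 2)%N.
    rewrite ltnNge; apply: contra ne => le2.
    suff -> : L = L' by [].
    apply/val_inj/genmx_fixed_eq => //; last by rewrite rL rL'.
    apply: submx_trans (capmxSr (val L) (val L')).
    by rewrite -(geq_leqif (mxrank_leqif_sup (capmxSl _ _))) rL.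
  by case: (\rank (val L :&: val L')%MS) => [|[|]] //; rewrite addn0 => _ le3 eq4;
    rewrite eq4 in le3.
have [Q eQ] := point_of rcap.
apply/eqP/cards1P; exists Q; apply/setP => P; rewrite !inE -sub_capmx.
rewrite -(genmxE (val L :&: val L')%MS) -eQ.
by apply/idP/eqP => [/PGpoint_sub_eq|->].
Qed.

Lemma PG2_join P P' : P != P' ->
  exists2 e, e \in PG2_edges K & (P \in e) && (P' \in e).
Proof.
move=> ne; have [_ rP] := PGpointP P; have [_ rP'] := PGpointP P'.
have rsum : \rank (val P + val P')%MS = 2%N.
  have := mxrank_sum_cap (val P) (val P'); rewrite rP rP'.
  suff -> : \rank (val P :&: val P')%MS = 0%N by rewrite addn0.
  apply/eqP; rewrite -leqn0 -ltnS ltnNge; apply: contra ne => le1.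
  apply/eqP/PGpoint_sub_eq; apply: submx_trans (capmxSr (val P) (val P')).
  by rewrite -(geq_leqif (mxrank_leqif_sup (capmxSl _ _))) rP.
have [L eL] := line_of rsum.
exists (points_on L); first by apply/imsetP; exists L.
by rewrite !inE eL !genmxE addsmxSl addsmxSr.
Qed.

Lemma PG2_edge_exists : exists e, e \in PG2_edges K.
Proof.
have [|L _] := line_of (A := pid_mx 2); first by rewrite rank_pid_mx.
by exists (points_on L); apply/imsetP; exists L.
Qed.

End ProjectivePlane.

Theorem mainTheorem11 (R : archiRealFieldType) (K : finFieldType) :
  let q := #|K| in
  exists2 eps0 : R, 0 < eps0 & forall eps : R, 0 < eps < eps0 ->
  exists2 th0 : R, 0 < th0 & forall th : R, 0 < th < th0 ->
  exists n0 : nat, forall n : nat, (n0 <= n)%N ->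
  forall delta : R, 0 < delta < 1 ->
  forall H : {set {set 'I_n}},
    (forall e, e \in H -> #|e| = q.+1) ->
    homdens R (PG2_edges K) H < th ->
    dens R q n (lowdeg q H delta) < th ->
    exists Z : {set 'I_n},
      (delta - eps) * n%:R < #|Z|%:R /\ dens R q.+1 #|Z| (induced H Z) < eps.
Proof.
move=> q; exists 1 => // eps /andP[eps0 _].
have [E0 E0_EF] := PG2_edge_exists K.
(* Any line may be taken as the line at infinity. *)
apply: (linear_space_dense_set E0_EF) eps0.
- exact: PG2_card_edge.
- exact: PG2_card_meet.
- exact: PG2_join.
- exact: ltnW (finNzRing_gt1 K).
Qed.
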